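(* Let $\alpha\in\mathbb{R}$ and $\beta\in[0,\tfrac32]$ with $\alpha\neq 0$ and $|\alpha|<\lambda_1^{\frac{3-2\beta}{2}}$. Let $(u,v)$ be a solution on $[0,\infty)$ of $$\begin{cases} u''+u'+Au+\alpha A^{\beta}v=0,\\ v''+A^2v+\alpha A^{\beta}u=0.\end{cases}$$ Then there exists a constant $c>0$ such that: (i) if $\beta\in[0,1]$, then for all $t>0$, $$\Vert A^{\frac{\beta}{2}-1}u'(t)\Vert_{W'}^2+\Vert A^{\frac{\beta}{2}-1}v'(t)\Vert_{W'}^2+\Vert A^{\frac{\beta-1}{2}}u(t)\Vert_{W'}^2+\Vert A^{\frac{\beta}{2}}v(t)\Vert_{W'}^2\le\frac{c}{t}\left[\Vert u'(0)\Vert^2+\Vert v'(0)\Vert^2+\Vert u(0)\Vert_V^2+\Vert v(0)\Vert_W^2\right];$$ (ii) if $\beta\in[1,\tfrac32]$, then for all $t>0$, $$\Vert A^{-\frac{\beta}{2}}u'(t)\Vert_{W'}^2+\Vert A^{-\frac{\beta}{2}}v'(t)\Vert_{W'}^2+\Vert A^{\frac{1-\beta}{2}}u(t)\Vert_{W'}^2+\Vert A^{1-\frac{\beta}{2}}v(t)\Vert_{W'}^2\le\frac{c}{t}\left[\Vert u'(0)\Vert^2+\Vert v'(0)\Vert^2+\Vert u(0)\Vert_V^2+\Vert v(0)\Vert_W^2\right].$$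
   Context: $H$ is a real Hilbert space with norm $\Vert\cdot\Vert$ and scalar product $\langle\cdot,\cdot\rangle$. $A$ is an unbounded closed self-adjoint operator on $H$ with domain $D(A)$ such that the injection $D(A)\subset H$ is dense and compact, and there is $a>0$ with $\langle Au,u\rangle\ge a\langle u,u\rangle$ for all $u\in D(A)$. $(e_n)_{n\ge1}$ is an orthonormal basis of $H$ of eigenvectors of $A$ with eigenvalues $(\lambda_n)_{n\ge 1}$ in nondecreasing order, so that $\lambda_1>0$ is the smallest eigenvalue (the largest admissible $a$). For real $s$, $A^s$ is defined spectrally by $A^su=\sum_n\lambda_n^s\langle u,e_n\rangle e_n$; for $s>0$ its domain is $D(A^s)=\{u\in H:\sum_n\lambda_n^{2s}\langle u,e_n\rangle^2<\infty\}$, $A^0=\mathrm{Id}$, and these operators are extended in the usual way to the scale of dual spaces. $V=D(A^{1/2})$ with $\Vert u\Vert_V=\Vert A^{1/2}u\Vert$, and $W=D(A)$ with $\Vert u\Vert_W=\Vert Au\Vert$. Identifying $H$ with its dual, $W\subset V\subset H\subset V'\subset W'$. The norm on $W'$ is $\Vert u\Vert_{W'}=\langle u,A^{-2}u\rangle_{W',W}^{1/2}$, so $\Vert u\Vert_{W'}=\Vert A^{-1}u\Vert$ for $u\in H$. Set $\mathcal{H}=V\times W\times H\times H$. A solution $(u,v)$ of the system is understood as the solution associated with initial data $(u(0),v(0),u'(0),v'(0))\in\mathcal{H}$, i.e. $(u,v,u',v')\in C([0,\infty);\mathcal{H})$, with the first equation holding in $V'$ and the second in $W'$. *)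

(* Defs.v *)
From HB Require Import structures.
From mathcomp Require Import all_boot all_order all_algebra.
From mathcomp Require Import all_classical all_reals all_analysis.

Set Implicit Arguments.
Unset Strict Implicit.
Unset Printing Implicit Defensive.

Import Order.TTheory GRing.Theory Num.Theory.
Import numFieldNormedType.Exports.

Local Open Scope classical_set_scope.
Local Open Scope ring_scope.

Section operator.
Context {R : realType} {H : completeNormedModType R}.
Variable dot : {dot H for (@idfun R)}.

(* A Hilbert space is a complete normed module whose norm is the one of the
   scalar product. *)
Definition hilbert_norm : Prop := forall u : H, dot u u = `|u| ^+ 2.

Variables (D : set H) (A : H -> H).

Definition linear_on : Prop :=
  D 0 /\ forall (k : R) u w, D u -> D w ->
    D (k *: u + w) /\ A (k *: u + w) = k *: A u + A w.

Definition closed_operator : Prop :=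
  closed [set p : H * H | D p.1 /\ A p.1 = p.2].

Definition unbounded_operator : Prop :=
  forall C : R, exists2 u, D u & C * `|u| < `|A u|.

(* (x, z) belongs to the graph of the adjoint of A. *)
Definition adjoint_graph (x z : H) : Prop :=
  forall w, D w -> dot (A w) x = dot w z.

Definition self_adjoint : Prop :=
  forall x z, adjoint_graph x z <-> D x /\ A x = z.

Definition compact_injection : Prop :=
  forall r : R, precompact [set u : H | D u /\ `|u| + `|A u| <= r].

Definition coercive : Prop :=
  exists2 a : R, 0 < a & forall u, D u -> a * dot u u <= dot (A u) u.

Record admissible_operator : Prop := AdmissibleOperator {
  adm_linear : linear_on ;
  adm_dense : dense D ;
  adm_unbounded : unbounded_operator ;
  adm_closed : closed_operator ;
  adm_self_adjoint : self_adjoint ;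
  adm_compact : compact_injection ;
  adm_coercive : coercive }.

(* The families are indexed from 0: [e n] and [lam n] are e_(n+1) and
   lambda_(n+1). *)
Record eigenbasis (e : nat -> H) (lam : nat -> R) : Prop := Eigenbasis {
  eig_orthonormal : forall m n, dot (e m) (e n) = (m == n)%:R ;
  eig_total : forall u : H,
    series (fun n => dot u (e n) *: e n) n @[n --> \oo] --> u ;
  eig_dom : forall n, D (e n) ;
  eig_eigen : forall n, A (e n) = lam n *: e n ;
  eig_sorted : {homo lam : m n / (m <= n)%N >-> m <= n} }.

End operator.

Section dual.
Context {R : realType} {H : completeNormedModType R}.

(* A subspace X of H carries its own norm nX.  An element of the dual of X is
   represented by a function f : H -> R of which only the values on X matter;
   u : H is identified with the functional [dot u]. *)
Variables (X : set H) (nX : H -> R).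

Definition dual_norm (f : H -> R) : \bar R :=
  ereal_sup [set (`|f w|)%:E | w in [set w | X w /\ nX w <= 1]].

Definition in_dual (f : H -> R) : Prop :=
  (forall (k : R) u w, X u -> X w -> f (k *: u + w) = k * f u + f w) /\
  (dual_norm f < +oo)%E.

Definition halfline_continuous (u : R -> H) : Prop :=
  forall t : R, 0 <= t ->
    X (u t) /\ nX (u s - u t) @[s --> within [set s | 0 <= s] (nbhs t)] --> 0.

(* Derivatives on [0, +oo[, one-sided at 0. *)
Definition halfline_derivative (u : R -> H) (t : R) (l : H) : Prop :=
  (s - t)^-1 *: (u s - u t) @[s --> within [set s | 0 <= s] t^'] --> l.

Definition halfline_dual_derivative
    (f : R -> H -> R) (t : R) (g : H -> R) : Prop :=
  dual_norm (fun w => (s - t)^-1 * (f s w - f t w) - g w)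
    @[s --> within [set s | 0 <= s] t^'] --> 0%E.

End dual.

Section scale.
Context {R : realType} {H : completeNormedModType R}.
Variables (dot : {dot H for (@idfun R)}) (D : set H) (A : H -> H).
Variables (e : nat -> H) (lam : nat -> R).

(* D(A^s); this is all of H when s <= 0. *)
Definition Adom (s : R) : set H :=
  [set u | cvgn (series (fun n => lam n `^ (2 * s) * dot u (e n) ^+ 2))].

(* A^s f as a vector of H, for a functional f such that the series converges
   in H. *)
Definition Avec (s : R) (f : H -> R) : H :=
  limn (series (fun n => (lam n `^ s * f (e n)) *: e n)).

Definition Apow (s : R) (u : H) : H := Avec s (dot u).

(* A^s f as a functional: the extension of A^s to the dual spaces. *)
Definition Aext (s : R) (f : H -> R) : H -> R :=
  fun w => limn (series (fun n => lam n `^ s * f (e n) * dot (e n) w)).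

Definition Vset : set H := Adom (1 / 2).
Definition normV (u : H) : R := `|Apow (1 / 2) u|.
Definition normW (u : H) : R := `|A u|.

(* The norm <f, A^(-2) f>^(1/2) of W', the bracket being the duality between
   W' and W. *)
Definition normW' (f : H -> R) : R := Num.sqrt (f (Avec (- 2) f)).

(* The W' norm of A^s u, for u such that A^s u is in H. *)
Definition normW'_Apow (s : R) (u : H) : R := normW' (dot (Apow s u)).

Record is_solution (alpha beta : R) (u v u' v' : R -> H) : Prop := IsSolution {
  sol_u : halfline_continuous Vset normV u ;
  sol_v : halfline_continuous D normW v ;
  sol_u' : halfline_continuous setT Num.norm u' ;
  sol_v' : halfline_continuous setT Num.norm v' ;
  sol_du : forall t : R, 0 <= t -> halfline_derivative u t (u' t) ;
  sol_dv : forall t : R, 0 <= t -> halfline_derivative v t (v' t) ;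
  sol_eq1 : forall t : R, 0 <= t -> exists u'' : H -> R,
    [/\ in_dual Vset normV u'',
        halfline_dual_derivative Vset normV (fun s => dot (u' s)) t u'' &
        forall w, Vset w ->
          u'' w + dot (u' t) w + Aext 1 (dot (u t)) w
            + alpha * Aext beta (dot (v t)) w = 0] ;
  sol_eq2 : forall t : R, 0 <= t -> exists v'' : H -> R,
    [/\ in_dual D normW v'',
        halfline_dual_derivative D normW (fun s => dot (v' s)) t v'' &
        forall w, D w ->
          v'' w + Aext 2 (dot (v t)) w
            + alpha * Aext beta (dot (u t)) w = 0] }.

End scale.

(* Main.v *)
Require Import Defs.
From mathcomp Require Import all_boot all_order all_algebra.
From mathcomp Require Import all_classical all_reals all_analysis.
From mathcomp Require Import ring lra.
Import Order.TTheory GRing.Theory Num.Theory.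
Import numFieldNormedType.Exports.
Local Open Scope classical_set_scope.
Local Open Scope ring_scope.

(** The system is diagonal in the basis [e]: the coordinates [u_n, v_n] of a
solution solve, with [lam = lam n],
  u_n'' + u_n' + lam u_n + alpha lam^beta v_n = 0,
  v_n'' + lam^2 v_n + alpha lam^beta u_n = 0,
and every norm in the estimate is a weighted l^2 sum of coordinates.  It is
therefore enough to prove, for each mode, a decay in 1/t whose dependence on
[lam] is explicit and whose constant is uniform, and then to sum over the modes.

Put [mu = lam^(1/2)], [U = mu u_n], [V = mu^2 v_n], [p = u_n'], [q = v_n'] and
[b = alpha lam^(beta - 3/2)].  The mode becomes
  U' = mu p,      p' = - p - mu U - b mu V,
  V' = mu^2 q,    q' = - mu^2 V - b mu^2 U,
and the hypothesis on alpha, with beta <= 3/2, says that [|b|] stays below a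
number delta < 1 for all modes.  Hence the energy
[E = (p^2 + q^2 + U^2 + V^2)/2 + b U V] is comparable with
[p^2 + q^2 + U^2 + V^2], and [E' = - p^2].  The damping sees only [p]; the
coupling transmits it to the other three variables through the multiplier
  X = b (p V - U q / mu) + 2 b^2 U p - (eps b^2 / mu) V q,  eps = (1 - delta)/2.
The combination [p V - U q / mu] is chosen so that the UV terms cancel in its
derivative, which leaves [- b mu V^2 + b mu U^2]: multiplied by b, whatever its
sign, it dissipates V at the expense of U.  The term [U p] pays for U, with the factor 2 that makes the resulting
quadratic form in (U, V) definite exactly when [|b| < 1], and a small multiple of
[- V q] dissipates q.  The remaining terms contain p and are absorbed by
[K mu^3 E], so that
  (K mu^3 E + X)' <= - (eps/2) b^2 mu E.
As E is nonincreasing, [K mu^3 E + X + (eps/2) b^2 mu t E] is nonincreasing too,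
and comparing its values at 0 and t gives
  t (b/mu)^2 E(t) <= C E(0),   where (b/mu)^2 = alpha^2 lam^(2 beta - 4)
(lemmas [multiplier_dissipation], [mode_decay], [solution_mode_decay]).

The left-hand side of (i) is the sum over the modes of
[lam^(beta - 4) (p^2 + q^2 + U^2 + V^2)] and that of (ii) is the same sum with
weight [lam^(- beta - 2)].  In their respective ranges of beta both exponents are
at most [2 beta - 4], and the eigenvalues are bounded below, so both estimates
are instances of [weighted_decay].  *)

(** * Decay of a single mode *)

Lemma young_inequality {R : realFieldType} {k} (x y : R) : 0 < k ->
  x * y <= k / 2 * x ^+ 2 + y ^+ 2 / (2 * k).
Proof.
move=> k0; rewrite -subr_ge0.
have -> : k / 2 * x ^+ 2 + y ^+ 2 / (2 * k) - x * y
    = (k * x - y) ^+ 2 / (2 * k) by field; rewrite gt_eqF.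
by rewrite divr_ge0 ?sqr_ge0 // mulr_ge0 // ltW.
Qed.

Lemma cross_term_ge {R : realFieldType} {d b} (x y : R) : `|b| <= d ->
  - (d / 2) * (x ^+ 2 + y ^+ 2) <= b * (x * y).
Proof.
rewrite ler_norml => /andP[lb ub].
have := mulr_ge0 (_ : 0 <= d + b) (sqr_ge0 (x + y)).
have := mulr_ge0 (_ : 0 <= d - b) (sqr_ge0 (x - y)).
rewrite subr_ge0 -lerBlDl sub0r => /(_ ub) h1 /(_ lb) h2.
nra.
Qed.

(** The left-hand side is the derivative of the multiplier [X] along a mode. The
quadratic form in (U, V) keeps a margin [eps] because [|b| <= 1 - 2 eps], and half
of the dissipation so obtained pays, by Young's inequality, for the products that
contain [p]. *)
Lemma multiplier_dissipation {R : realFieldType} {eps b mu} (p q U V : R) :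
    0 < eps -> `|b| <= 1 - 2 * eps -> 0 < mu ->
  - (b ^+ 2 * mu) * (U ^+ 2 + (1 - eps) * V ^+ 2 + (2 - eps) * (b * (U * V))
                     + eps * q ^+ 2)
  + b * (mu ^+ 2 - 1) * (p * q) - b * (p * V) + 2 * b ^+ 2 * mu * p ^+ 2
  - 2 * b ^+ 2 * (U * p)
  <= (((mu ^+ 2 - 1) ^+ 2 + 5) / (2 * eps * mu) + 2 * mu) * p ^+ 2
     - eps / 2 * (b ^+ 2 * mu) * (U ^+ 2 + V ^+ 2 + q ^+ 2).
Proof.
move=> e0 hb mu0; have d0 := le_trans (normr_ge0 b) hb.
have b21 : b ^+ 2 <= 1.
  by rewrite -real_normK ?num_real // expr_le1 //; lra.
have k0 : 0 < eps * mu by rewrite mulr_gt0.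
have hpq := young_inequality (b * q) ((mu ^+ 2 - 1) * p) k0.
have hpV := young_inequality (b * V) (- p) k0.
have hUp := young_inequality (b * U) (- (2 * b * p)) k0.
have hUV := cross_term_ge U V hb.
have w0 : 0 <= b ^+ 2 * mu by rewrite mulr_ge0 ?sqr_ge0 // ltW.
have hUV' := ler_wpM2l (_ : 0 <= b ^+ 2 * mu * (2 - eps)) hUV.
have {}hUV' := hUV' (mulr_ge0 w0 (ltac:(lra) : 0 <= 2 - eps)).
have i0 : 0 <= (2 * (eps * mu))^-1 by rewrite invr_ge0 mulr_ge0 // ltW.
have h4 : 4 * b ^+ 2 * (p ^+ 2 / (2 * (eps * mu)))
    <= 4 * (p ^+ 2 / (2 * (eps * mu))).
  apply: ler_wpM2r; first by rewrite mulr_ge0 // sqr_ge0.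
  lra.
have hp : b ^+ 2 * (mu * p ^+ 2) <= mu * p ^+ 2.
  by rewrite ler_piMl // mulr_ge0 ?sqr_ge0 // ltW.
have hU : 0 <= b ^+ 2 * mu * ((5 / 2 - eps) * eps * U ^+ 2).
  rewrite mulr_ge0 // mulr_ge0 ?sqr_ge0 // mulr_ge0 //; lra.
have hV : 0 <= b ^+ 2 * mu * ((1 / 2 - eps) * eps * V ^+ 2).
  rewrite mulr_ge0 // mulr_ge0 ?sqr_ge0 // mulr_ge0 //; lra.
have E : 2 * eps * mu = 2 * (eps * mu) by ring.
rewrite E; set i := (2 * (eps * mu))^-1 in hpq hpV hUp h4 i0 *.
nra.
Qed.

(** All the constants met in the Lyapunov argument are polynomial in [mu] and [1/mu]
and of order at most 3 for large [mu]; a lower bound on [mu] makes [K mu^3] dominate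
them with [K] independent of the mode. The first inequality absorbs the [p^2] terms,
the second one makes [K mu^3 E + X] nonnegative. *)
Lemma cubic_weight_dominates {R : realFieldType} {eps m : R} :
    0 < eps -> 0 < m ->
  exists2 K : R, 0 < K & forall mu, m <= mu ->
    ((mu ^+ 2 - 1) ^+ 2 + 5) / (2 * eps * mu) + 3 * mu <= K * mu ^+ 3 /\
    2 + mu^-1 <= eps * (K * mu ^+ 3).
Proof.
move=> e0 m0.
pose K1 := (1 + 6 / m ^+ 4) / (2 * eps); pose K2 := 3 / m ^+ 2.
pose K3 := (2 / m ^+ 3 + 1 / m ^+ 4) / eps.
have mn n : 0 < m ^+ n by rewrite exprn_gt0.
have K10 : 0 < K1 by rewrite divr_gt0 ?mulr_gt0 // addr_gt0 ?divr_gt0 ?mn.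
have K20 : 0 < K2 by rewrite divr_gt0 ?mn.
have K30 : 0 < K3 by rewrite divr_gt0 // addr_gt0 ?divr_gt0 ?mn.
exists (K1 + K2 + K3); first by rewrite !addr_gt0.
move=> mu mmu; have mu0 : 0 < mu := lt_le_trans m0 mmu.
have one n : 1 <= mu ^+ n / m ^+ n.
  by rewrite ler_pdivlMr ?mn // mul1r lerXn2r ?nnegrE // ltW.
have mun n : 0 < mu ^+ n by rewrite exprn_gt0.
have w1 : 0 <= K1 * mu ^+ 3 by rewrite ltW // mulr_gt0.
have w2 : 0 <= K2 * mu ^+ 3 by rewrite ltW // mulr_gt0.
have w3 : 0 <= K3 * mu ^+ 3 by rewrite ltW // mulr_gt0.
have meq0 : m != 0 by rewrite gt_eqF.
have eeq0 : eps != 0 by rewrite gt_eqF.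
have mueq0 : mu != 0 by rewrite gt_eqF.
have h1 : ((mu ^+ 2 - 1) ^+ 2 + 5) / (2 * eps * mu) <= K1 * mu ^+ 3.
  rewrite ler_pdivrMr ?mulr_gt0 //.
  have -> : K1 * mu ^+ 3 * (2 * eps * mu) = mu ^+ 4 + 6 * (mu ^+ 4 / m ^+ 4).
    by rewrite /K1; field; rewrite ?meq0 ?eeq0 ?mueq0.
  have := one 4%N; have := mun 2%N; nra.
have h2 : 3 * mu <= K2 * mu ^+ 3.
  have -> : K2 * mu ^+ 3 = 3 * mu * (mu ^+ 2 / m ^+ 2) by rewrite /K2; field.
  by rewrite ler_peMr ?one // mulr_ge0 // ltW.
have h3 : 2 + mu^-1 <= eps * (K3 * mu ^+ 3).
  have -> : eps * (K3 * mu ^+ 3)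
      = 2 * (mu ^+ 3 / m ^+ 3) + mu ^+ 4 / m ^+ 4 * mu^-1.
    by rewrite /K3; field; rewrite ?meq0 ?eeq0 ?mueq0.
  apply: lerD; first by rewrite ler_peMr ?one.
  by rewrite ler_peMl ?one // invr_ge0 ltW.
have -> : (K1 + K2 + K3) * mu ^+ 3 = K1 * mu ^+ 3 + K2 * mu ^+ 3 + K3 * mu ^+ 3.
  by ring.
split; first lra.
rewrite !mulrDr; have := mulr_ge0 (ltW e0) w1; have := mulr_ge0 (ltW e0) w2.
lra.
Qed.


Lemma antitone_of_derive_le0 {R : realType} {f df : R -> R} :
    (forall t : R, 0 <= t -> is_derive t (1 : R) f (df t)) ->
    (forall t : R, 0 <= t -> df t <= 0) ->
  forall t : R, 0 <= t -> f t <= f 0.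
Proof.
move=> hf hdf t t0.
have itv x : x \in `[0, t] -> 0 <= x by rewrite in_itv /= => /andP[].
have itvo x : x \in `]0, t[ -> 0 <= x by rewrite in_itv /= => /andP[/ltW].
apply: (@ler0_derive1_le_cc _ f 0 t) => //.
- by move=> x /itvo x0; have [] := hf x x0.
- move=> x /itvo x0; have [_ fx] := hf x x0; rewrite derive1E fx.
  exact: hdf.
- apply: derivable_within_continuous => x /itv x0.
  by have [] := hf x x0.
- by rewrite in_itv /= lexx t0.
- by rewrite in_itv /= lexx t0.
Qed.

Definition mode_norm2 {R : realType} (p q U V : R) : R :=
  p ^+ 2 + q ^+ 2 + U ^+ 2 + V ^+ 2.

Definition mode_energy {R : realType} (b p q U V : R) : R :=
  mode_norm2 p q U V / 2 + b * (U * V).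

(** In the derivative of [b (p V - U q / mu)] the UV terms cancel, leaving a damping of
V and an antidamping of U that the second term corrects; the third term damps q. *)
Definition mode_multiplier {R : realType} (eps b mu p q U V : R) : R :=
  b * (p * V - U * q / mu) + 2 * b ^+ 2 * (U * p) - eps * b ^+ 2 / mu * (V * q).

Lemma mode_energy_bounds {R : realType} {eps b : R} (p q U V : R) :
    0 < eps -> `|b| <= 1 - 2 * eps ->
  eps * mode_norm2 p q U V <= mode_energy b p q U V <= mode_norm2 p q U V.
Proof.
move=> e0 hb; rewrite /mode_energy /mode_norm2.
have d0 := le_trans (normr_ge0 b) hb.
have hb' : `|- b| <= 1 - 2 * eps by rewrite normrN.
have := cross_term_ge U V hb; have := cross_term_ge U V hb'.
have hU : 0 <= U ^+ 2 := sqr_ge0 _; have hV : 0 <= V ^+ 2 := sqr_ge0 _.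
have hp : 0 <= p ^+ 2 := sqr_ge0 _; have hq : 0 <= q ^+ 2 := sqr_ge0 _.
have := mulr_ge0 d0 hp; have := mulr_ge0 d0 hq.
have := mulr_ge0 (ltW e0) hU; have := mulr_ge0 (ltW e0) hV.
by move=> *; apply/andP; split; lra.
Qed.

Lemma mode_multiplier_bound {R : realType} {eps b mu : R} (p q U V : R) :
    0 < eps -> `|b| <= 1 - 2 * eps -> 0 < mu ->
  `|mode_multiplier eps b mu p q U V|
    <= (2 + mu^-1) * mode_norm2 p q U V.
Proof.
rewrite /mode_norm2.
move=> e0 hb mu0; have d0 := le_trans (normr_ge0 b) hb.
have b1 : `|b| <= 1 by lra.
have b21 : `|b ^+ 2| <= 1 by rewrite normrX expr_le1.
have i0 : 0 < mu^-1 by rewrite invr_gt0.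
have young (x y : R) : `|x * y| <= (x ^+ 2 + y ^+ 2) / 2.
  rewrite ler_norml; apply/andP; split; last first.
    have := sqr_ge0 (x - y); rewrite sqrrB mulr2n; lra.
  have := sqr_ge0 (x + y); rewrite sqrrD mulr2n; lra.
have bnd (c k x : R) : `|c| <= k -> `|c * x| <= k * `|x|.
  by move=> ck; rewrite normrM ler_wpM2r.
have h1 : `|b * (p * V)| <= 1 * `|p * V| by apply: bnd.
have h2 : `|b / mu * (U * q)| <= mu^-1 * `|U * q|.
  apply: bnd; rewrite normrM [`|mu^-1|]gtr0_norm //.
  by rewrite ler_piMl // ltW.
have h3 : `|2 * b ^+ 2 * (U * p)| <= 2 * `|U * p|.
  by apply: bnd; rewrite normrM ger0_norm // ler_piMr.
have h4 : `|eps * b ^+ 2 / mu * (V * q)| <= mu^-1 * `|V * q|.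
  apply: bnd; rewrite normrM [`|mu^-1|]gtr0_norm // normrM [`|eps|]gtr0_norm //.
  rewrite ler_piMl ?(ltW i0) // mulr_ile1 ?(ltW e0) //; lra.
have -> : mode_multiplier eps b mu p q U V
   = b * (p * V) - b / mu * (U * q) + 2 * b ^+ 2 * (U * p)
     - eps * b ^+ 2 / mu * (V * q).
  by rewrite /mode_multiplier; ring.
apply: le_trans (ler_normB _ _) _.
apply: le_trans (lerD (ler_normD _ _) (lexx _)) _.
apply: le_trans (lerD (lerD (ler_normB _ _) (lexx _)) (lexx _)) _.
have y2 := ler_wpM2l (ltW i0) (young U q).
have y4 := ler_wpM2l (ltW i0) (young V q).
have := young p V; have := young U p.
have : 0 <= p ^+ 2 := sqr_ge0 _; have : 0 <= q ^+ 2 := sqr_ge0 _.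
have : 0 <= U ^+ 2 := sqr_ge0 _; have : 0 <= V ^+ 2 := sqr_ge0 _.
move=> a1 a2 a3 a4.
have := mulr_ge0 (ltW i0) a1; have := mulr_ge0 (ltW i0) a2.
have := mulr_ge0 (ltW i0) a3; have := mulr_ge0 (ltW i0) a4.
lra.
Qed.

(** [C] depends on the mode neither through [b] nor through [mu]: this uniformity is
what allows summing over the modes. *)
Lemma mode_decay {R : realType} {eps m : R} : 0 < eps -> 0 < m ->
  exists2 C : R, 0 < C & forall (b mu : R) (p q U V : R -> R),
    `|b| <= 1 - 2 * eps -> m <= mu ->
    (forall t : R, 0 <= t -> is_derive t (1 : R) U (mu * p t)) ->
    (forall t : R, 0 <= t ->
      is_derive t (1 : R) p (- p t - mu * U t - b * mu * V t)) ->
    (forall t : R, 0 <= t -> is_derive t (1 : R) V (mu ^+ 2 * q t)) ->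
    (forall t : R, 0 <= t ->
      is_derive t (1 : R) q (- (mu ^+ 2 * V t) - b * mu ^+ 2 * U t)) ->
    forall t : R, 0 <= t ->
      t * (b / mu) ^+ 2 * mode_norm2 (p t) (q t) (U t) (V t)
        <= C * mode_norm2 (p 0) (q 0) (U 0) (V 0).
Proof.
move=> e0 m0; have [K K0 hK] := cubic_weight_dominates e0 m0.
exists (4 * K / eps ^+ 2); first by rewrite divr_gt0 ?mulr_gt0 ?exprn_gt0.
move=> b mu p q U V hb mmu dU dp dV dq.
have mu0 : 0 < mu := lt_le_trans m0 mmu.
have mueq0 : mu != 0 by rewrite gt_eqF.
have [hN hNe] := hK mu mmu; set N := K * mu ^+ 3 in hN hNe.
have N0 : 0 < N by rewrite mulr_gt0 ?exprn_gt0.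
pose S t := mode_norm2 (p t) (q t) (U t) (V t).
pose E t := mode_energy b (p t) (q t) (U t) (V t).
pose X t := mode_multiplier eps b mu (p t) (q t) (U t) (V t).
have S0 t : 0 <= S t by rewrite /S /mode_norm2 !addr_ge0 ?sqr_ge0.
have d0 := le_trans (normr_ge0 b) hb.
have b21 : b ^+ 2 <= 1.
  by rewrite -real_normK ?num_real // expr_le1 //; lra.
have dE (t : R) : 0 <= t -> is_derive t (1 : R) E (- p t ^+ 2).
  move=> t0; have dUt := dU t t0; have dpt := dp t t0.
  have dVt := dV t t0; have dqt := dq t t0.
  rewrite /E /mode_energy /mode_norm2.
  by apply: is_derive_eq; rewrite /GRing.scale /=; field.
have dX (t : R) : 0 <= t -> is_derive t (1 : R) X
    (- (b ^+ 2 * mu) * (U t ^+ 2 + (1 - eps) * V t ^+ 2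
                        + (2 - eps) * (b * (U t * V t)) + eps * q t ^+ 2)
     + b * (mu ^+ 2 - 1) * (p t * q t) - b * (p t * V t)
     + 2 * b ^+ 2 * mu * p t ^+ 2 - 2 * b ^+ 2 * (U t * p t)).
  move=> t0; have dUt := dU t t0; have dpt := dp t t0.
  have dVt := dV t t0; have dqt := dq t t0.
  rewrite /X /mode_multiplier.
  by apply: is_derive_eq; rewrite /GRing.scale /=; field.
pose k := eps / 2 * (b ^+ 2 * mu).
have k0 : 0 <= k.
  by apply: mulr_ge0; [rewrite divr_ge0 // ltW | rewrite mulr_ge0 ?sqr_ge0 // ltW].
(* The term in [t E t] turns the integrated dissipation into a pointwise bound
   without integrating: its derivative is at most [k * E t]. *)
pose Phi t := N * E t + X t + k * (t * E t).
have dPhi (t : R) : 0 <= t -> is_derive t (1 : R) Phi (N * (- p t ^+ 2)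
    + (- (b ^+ 2 * mu) * (U t ^+ 2 + (1 - eps) * V t ^+ 2
                        + (2 - eps) * (b * (U t * V t)) + eps * q t ^+ 2)
     + b * (mu ^+ 2 - 1) * (p t * q t) - b * (p t * V t)
     + 2 * b ^+ 2 * mu * p t ^+ 2 - 2 * b ^+ 2 * (U t * p t))
    + k * (E t - t * p t ^+ 2)).
  move=> t0; have dEt := dE t t0; have dXt := dX t t0.
  rewrite /Phi.
  by apply: is_derive_eq; rewrite /GRing.scale /=; ring.
have Phi_le t : 0 <= t -> Phi t <= Phi 0.
  apply: (antitone_of_derive_le0 dPhi) => {}t t0.
  have hX := multiplier_dissipation (p t) (q t) (U t) (V t) e0 hb mu0.
  have /andP[_ ES] := mode_energy_bounds (p t) (q t) (U t) (V t) e0 hb.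
  rewrite -/(E t) /mode_norm2 in ES.
  have hp : 0 <= p t ^+ 2 := sqr_ge0 _.
  have hNp := ler_wpM2r hp hN.
  have hkE := ler_wpM2l k0 ES.
  have hkt : 0 <= k * (t * p t ^+ 2) by do 2 apply: mulr_ge0 => //.
  have hk : k * p t ^+ 2 <= mu * p t ^+ 2.
    rewrite ler_wpM2r // /k mulrA ler_piMl ?(ltW mu0) //.
    by rewrite mulr_ile1 ?sqr_ge0 //; lra.
  rewrite -/k in hX.
  lra.
move=> t t0; have := Phi_le t t0.
have /andP[_ ES0] := mode_energy_bounds (p 0) (q 0) (U 0) (V 0) e0 hb.
have /andP[ESt _] := mode_energy_bounds (p t) (q t) (U t) (V t) e0 hb.
have Xb s : `|X s| <= eps * N * S s.
  apply: le_trans (mode_multiplier_bound _ _ _ _ e0 hb mu0) _.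
  exact: (ler_wpM2r (S0 s) hNe).
have := Xb 0; have := Xb t; rewrite !ler_norml => /andP[Xt _] /andP[_ X0].
rewrite -/(E 0) -/(S 0) in ES0; rewrite -/(E t) -/(S t) in ESt.
have hNS := ler_wpM2l (ltW N0) ESt; have hNS0 := ler_wpM2l (ltW N0) ES0.
have hkS : k * (t * (eps * S t)) <= k * (t * E t) by rewrite !ler_wpM2l.
rewrite /Phi mul0r mulr0 addr0 => Phit.
have eNS : eps * N * S 0 <= N * S 0.
  by rewrite -mulrA ler_piMl ?mulr_ge0 // ?(ltW N0) //; lra.
have main : k * (t * (eps * S t)) <= 2 * N * S 0 by lra.
have c0 : 0 < eps ^+ 2 * mu ^+ 3 / 2 by rewrite divr_gt0 ?mulr_gt0 ?exprn_gt0.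
rewrite -(ler_pM2l c0).
have -> : eps ^+ 2 * mu ^+ 3 / 2 * (t * (b / mu) ^+ 2 * S t)
    = k * (t * (eps * S t)) by rewrite /k; field.
have -> // : eps ^+ 2 * mu ^+ 3 / 2 * (4 * K / eps ^+ 2 * S 0) = 2 * N * S 0.
by rewrite /N; field; rewrite gt_eqF.
Qed.

(** * Orthonormal series and powers of the operator *)

Section scalar_product.
Context {R : realType} {H : completeNormedModType R}.
Context {dot : {dot H for (@idfun R)}} (hH : hilbert_norm dot).

Lemma dotC x y : dot x y = dot y x.
Proof. by rewrite [LHS]hermitian_subproof expr0 mul1r. Qed.

Lemma dotZl k x y : dot (k *: x) y = k * dot x y.
Proof. exact: linearZl_LR. Qed.

Lemma dotZr k x y : dot x (k *: y) = k * dot x y.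
Proof. by rewrite dotC dotZl dotC. Qed.

Lemma dot_suml I (r : seq I) (P : pred I) (f : I -> H) y :
  dot (\sum_(i <- r | P i) f i) y = \sum_(i <- r | P i) dot (f i) y.
Proof. exact: linear_sumlz. Qed.

Lemma dot_ge0 x : 0 <= dot x x.
Proof. by rewrite hH sqr_ge0. Qed.

Lemma dot_le_norm x y : `|dot x y| <= `|x| * `|y|.
Proof.
have [->|y0] := eqVneq y 0; first by rewrite linear0r !normr0 mulr0.
have ny : 0 < `|y| ^+ 2 by rewrite exprn_gt0 // normr_gt0.
rewrite -ler_sqr ?nnegrE ?mulr_ge0 // real_normK ?num_real // exprMn.
pose c := dot x y / `|y| ^+ 2.
have := dot_ge0 (x - c *: y).
rewrite linearBl !linearBr /= !dotZl !dotZr !hH (dotC y x).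
have -> : `|x| ^+ 2 - c * dot x y - (c * dot x y - c * (c * `|y| ^+ 2))
    = `|x| ^+ 2 - dot x y ^+ 2 / `|y| ^+ 2.
  by rewrite /c; field; rewrite normr_eq0.
by rewrite subr_ge0 ler_pdivrMr.
Qed.

Lemma dot_cvg {T : Type} {F : set_system T} {FF : Filter F} (f : T -> H) (l y : H) :
  f x @[x --> F] --> l -> dot (f x) y @[x --> F] --> dot l y.
Proof.
move=> /cvgrPdist_lt fl; apply/cvgrPdist_lt => eps e0.
have y1 : 0 < `|y| + 1 by rewrite ltr_wpDl.
have := fl _ (divr_gt0 e0 y1); apply: filterS => x hx.
rewrite -linearBl; apply: le_lt_trans (dot_le_norm _ _) _.
apply: (@le_lt_trans _ _ (`|l - f x| * (`|y| + 1))).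
  by rewrite ler_wpM2l // lerDl.
by rewrite -ltr_pdivlMr.
Qed.

Lemma dot_lim_series (f : nat -> H) y : cvgn (series f) ->
  series (fun n => dot (f n) y) @ \oo --> dot (limn (series f)) y.
Proof.
move=> cf.
have -> : series (fun n => dot (f n) y) = fun n => dot (series f n) y.
  by apply/funext => n; rewrite /series /= dot_suml.
exact: dot_cvg cf.
Qed.

End scalar_product.

Lemma cvg_series_single {R : numFieldType} {V : normedModType R} (f : nat -> V) n :
  (forall m, m != n -> f m = 0) -> series f @ \oo --> f n.
Proof.
move=> f0; apply: cvg_near_cst; exists n.+1 => // N /= nN.
rewrite /series /= big_mkord (bigD1 (Ordinal nN)) //= big1 ?addr0 // => i ni.
exact: f0.
Qed.

Lemma is_cvg_series_bounded {R : realType} (f : nat -> R) (M : R) :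
  (forall n, 0 <= f n) -> (forall n, series f n <= M) -> cvgn (series f).
Proof.
move=> f0 fM; apply: nondecreasing_is_cvgn.
  by apply: nondecreasing_series => n _.
by exists M => _ [n _ <-].
Qed.

Lemma series_le_lim {R : realType} (f : nat -> R) n :
  (forall n, 0 <= f n) -> cvgn (series f) -> series f n <= limn (series f).
Proof.
move=> f0 cf; apply: nondecreasing_cvgn_le => //.
by apply: nondecreasing_series => m _.
Qed.

Section orthonormal_series.
Context {R : realType} {H : completeNormedModType R}.
Context {dot : {dot H for (@idfun R)}} (hH : hilbert_norm dot).
Context {e : nat -> H} (e_on : forall m n, dot (e m) (e n) = (m == n)%:R).

Lemma norm_orthonormal n : `|e n| = 1.
Proof.
apply/eqP; rewrite -(@pexpr_eq1 _ _ 2) //; apply/eqP.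
by rewrite -hH e_on eqxx.
Qed.

Lemma norm_orthonormal_sum (c : nat -> R) (r : seq nat) : uniq r ->
  `|\sum_(k <- r) c k *: e k| ^+ 2 = \sum_(k <- r) c k ^+ 2.
Proof.
move=> ur; rewrite -hH dot_suml; apply: eq_big_seq => k kr.
rewrite dotZl dotC dot_suml (bigD1_seq k) //= dotZl e_on eqxx mulr1.
rewrite big1 ?addr0 // => j jk.
by rewrite dotZl e_on (negbTE jk) mulr0.
Qed.

Lemma is_cvg_orthonormal_series (c : nat -> R) :
  cvgn (series (fun n => c n ^+ 2)) -> cvgn (series (fun n => c n *: e n)).
Proof.
move=> /cauchy_cvgP /cauchy_seriesP cc; apply/cauchy_cvgP/cauchy_seriesP => eps e0.
have := cc _ (exprn_gt0 2 e0); apply: filterS => -[m n] /= hmn.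
rewrite -ltr_sqr ?nnegrE ?(ltW e0) //.
rewrite norm_orthonormal_sum ?iota_uniq //.
exact: le_lt_trans (ler_norm _) hmn.
Qed.

Lemma dot_orthonormal_series (c : nat -> R) n :
  cvgn (series (fun n => c n *: e n)) ->
  dot (limn (series (fun n => c n *: e n))) (e n) = c n.
Proof.
move=> cc; have h := dot_lim_series hH _ (e n) cc.
apply: (cvg_unique _ h) => //.
have := @cvg_series_single _ _ (fun m => dot (c m *: e m) (e n)) n.
rewrite dotZl e_on eqxx mulr1; apply => m mn.
by rewrite dotZl e_on (negbTE mn) mulr0.
Qed.

Lemma bessel x N : \sum_(0 <= n < N) dot x (e n) ^+ 2 <= `|x| ^+ 2.
Proof.
have := dot_ge0 hH (x - \sum_(0 <= n < N) dot x (e n) *: e n).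
rewrite linearBl !linearBr /= !hH norm_orthonormal_sum ?iota_uniq //.
have hx : dot (\sum_(0 <= n < N) dot x (e n) *: e n) x
    = \sum_(0 <= n < N) dot x (e n) ^+ 2.
  by rewrite dot_suml; apply: eq_bigr => n _; rewrite dotZl (dotC _ x) expr2.
rewrite (dotC x) hx.
lra.
Qed.

End orthonormal_series.

Lemma powR_sqr {R : realType} (a s : R) : 0 <= a -> (a `^ s) ^+ 2 = a `^ (2 * s).
Proof. by move=> a0; rewrite mulrC powRrM powR_mulrn ?powR_ge0. Qed.

Lemma powR_half_sqr {R : realType} (a : R) : 0 <= a -> (a `^ (1 / 2)) ^+ 2 = a.
Proof.
move=> a0; rewrite powR_sqr //.
have -> : 2 * (1 / 2) = 1 :> R by field.
by rewrite powRr1.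
Qed.

Lemma ler_powR_npos {R : realType} (a b s : R) :
  0 < a -> a <= b -> s <= 0 -> b `^ s <= a `^ s.
Proof.
move=> a0 ab s0; rewrite -[s]opprK !(powRN _ (- s)).
rewrite lef_pV2 ?posrE ?powR_gt0 ?(lt_le_trans a0 ab) //.
by rewrite ge0_ler_powR ?nnegrE ?oppr_ge0 // ltW // (lt_le_trans a0 ab).
Qed.

Section spectral_scale.
Context {R : realType} {H : completeNormedModType R}.
Context {dot : {dot H for (@idfun R)}} (hH : hilbert_norm dot).
Context {e : nat -> H} (e_on : forall m n, dot (e m) (e n) = (m == n)%:R).
Context (e_total : forall x : H,
  series (fun n => dot x (e n) *: e n) n @[n --> \oo] --> x).
Context {lam : nat -> R} (lam0_gt0 : 0 < lam 0%N).
Context (lam_ge : forall n, lam 0%N <= lam n).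

Let lam_gt0 n : 0 < lam n.
Proof. exact: lt_le_trans (lam_ge n). Qed.

(** Expand [x] in the basis and use the continuity of the scalar product. *)
Lemma parseval x y : series (fun n => dot x (e n) * dot y (e n)) @ \oo --> dot x y.
Proof.
have cx : cvgn (series (fun n => dot x (e n) *: e n)).
  by apply/cvg_ex; exists x; exact: e_total.
have := dot_lim_series hH _ y cx.
rewrite (cvg_lim _ (e_total x)) //.
under [X in series X]eq_fun do rewrite dotZl (dotC _ y).
by [].
Qed.

(** Eigenvalues are bounded below, so larger exponents give smaller domains, also for
negative exponents. *)
Lemma Adom_le {r s x} : r <= s -> Adom dot e lam s x -> Adom dot e lam r x.
Proof.
rewrite /Adom /= => rs cs.
have pos q n : 0 <= lam n `^ q * dot x (e n) ^+ 2.
  by rewrite mulr_ge0 ?sqr_ge0 ?powR_ge0.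
apply: (@is_cvg_series_bounded _ _ (lam 0%N `^ (2 * (r - s))
    * limn (series (fun n => lam n `^ (2 * s) * dot x (e n) ^+ 2)))) => // n.
have h := series_le_lim _ n (pos _) cs.
apply: le_trans (ler_wpM2l (powR_ge0 _ _) h).
rewrite /series /= mulr_sumr ler_sum // => k _.
rewrite [leRHS]mulrA ler_wpM2r ?sqr_ge0 //.
have -> : 2 * r = 2 * (r - s) + 2 * s by ring.
rewrite powRD; last by rewrite (gt_eqF (lam_gt0 k)) implybT.
by rewrite ler_wpM2r ?powR_ge0 // ler_powR_npos //; lra.
Qed.

Lemma Adom0 x : Adom dot e lam 0 x.
Proof.
apply: (@is_cvg_series_bounded _ _ (`|x| ^+ 2)) => n.
  by rewrite mulr_ge0 ?sqr_ge0 ?powR_ge0.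
apply: le_trans (bessel hH e_on x n); rewrite /series /=.
by apply: ler_sum => k _; rewrite mulr0 powRr0 mul1r.
Qed.

Lemma is_cvg_Apow s x : Adom dot e lam s x ->
  cvgn (series (fun n => (lam n `^ s * dot x (e n)) *: e n)).
Proof.
move=> sx; apply: is_cvg_orthonormal_series => //.
by under eq_fun do rewrite exprMn powR_sqr ?(ltW (lam_gt0 _)) //.
Qed.

Lemma dot_Apow s x n : Adom dot e lam s x ->
  dot (Apow dot e lam s x) (e n) = lam n `^ s * dot x (e n).
Proof. by move=> sx; rewrite (dot_orthonormal_series hH e_on) //; exact: is_cvg_Apow. Qed.

(** The norm of W' and the power of A are both limits of series, which default to a
junk value when they diverge; membership of [x] in D(A^s) rules this out. *)
Lemma normW'_Apow_sqr_cvg {s x} : Adom dot e lam s x ->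
  series (fun n => lam n `^ (2 * s - 2) * dot x (e n) ^+ 2) @ \oo
    --> normW'_Apow dot e lam s x ^+ 2.
Proof.
move=> sx; rewrite /normW'_Apow /normW'.
set y := Apow dot e lam s x.
have ydom : Adom dot e lam (- 2) y by apply: Adom_le (Adom0 y); lra.
rewrite -[Avec _ _ _ _]/(Apow dot e lam (- 2) y); set z := Apow _ _ _ _ y.
have := parseval y z.
have -> : (fun n => dot y (e n) * dot z (e n))
    = fun n => lam n `^ (2 * s - 2) * dot x (e n) ^+ 2.
  apply/funext => n; rewrite /z dot_Apow // /y dot_Apow //.
  rewrite [2 * s](_ : _ = s + s); last by ring.
  rewrite !powRD; try by rewrite (gt_eqF (lam_gt0 n)) implybT.
  by ring.
move=> c; rewrite sqr_sqrtr //.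
rewrite -(cvg_lim _ c) //; apply: limr_ge; first by apply/cvg_ex; eexists; exact: c.
by apply: nearW => n; rewrite sumr_ge0 // => k _; rewrite mulr_ge0 ?sqr_ge0 ?powR_ge0.
Qed.

Lemma sum_le_normV_sqr {x} N : Vset dot e lam x ->
  \sum_(0 <= n < N) lam n * dot x (e n) ^+ 2 <= normV dot e lam x ^+ 2.
Proof.
move=> xV; apply: le_trans (bessel hH e_on _ N).
by apply: ler_sum => n _; rewrite dot_Apow // exprMn powR_half_sqr // ltW.
Qed.

End spectral_scale.

(** * From solutions to modes *)

(** Prolonging a function of the half-line by its tangent at 0 gives a function with
two-sided derivatives at all t >= 0, to which the usual differential calculus
applies up to the endpoint. *)
Lemma halfline_derivative_extension {R : realType} {f df : R -> R} :
    (forall t : R, 0 <= t ->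
      (s - t)^-1 * (f s - f t) @[s --> within [set s | 0 <= s] t^'] --> df t) ->
  exists F : R -> R, (forall t : R, 0 <= t -> F t = f t) /\
    (forall t : R, 0 <= t -> is_derive t (1 : R) F (df t)).
Proof.
move=> hf; pose F t := if 0 <= t then f t else f 0 + t * df 0.
have F_ge0 t : 0 <= t -> F t = f t by rewrite /F => ->.
exists F; split => // t t0.
suff h : h^-1 *: (F (h *: 1 + t) - F t) @[h --> 0^'] --> df t.
  by split; [apply/cvg_ex; exists (df t) | exact: cvg_lim].
apply/cvgrPdist_lt => eps e0.
have /cvgrPdist_lt /(_ _ e0) := hf t t0.
rewrite near_withinE => /nbhs_ballP [d /= d0 hd].
(* At t = 0 negative increments see the tangent; at t > 0 the radius is reduced
   so that they stay in the half-line. *)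
pose d' := if t == 0 then d else Num.min d t.
have d'0 : 0 < d'.
  by rewrite /d'; case: eqVneq => // tn; rewrite lt_min d0 lt_def tn.
have d'd : d' <= d by rewrite /d'; case: eqVneq => // tn; rewrite ge_min lexx.
apply/nbhs_ballP; exists d' => //= h.
rewrite /ball /= sub0r normrN => hd' h0.
have hE : h *: 1 + t = h + t by rewrite /GRing.scale /= mulr1.
rewrite hE (F_ge0 t) //.
have [s0|s0] := leP 0 (h + t).
  have := hd (h + t); rewrite /ball /= opprD addrCA subrr addr0 normrN addrK.
  rewrite (F_ge0 _ s0); apply => //; first exact: lt_le_trans d'd.
  by rewrite -subr_eq0 addrK.
have tE : t = 0.
  apply/eqP; apply: contraTT hd' => tn; rewrite -leNgt /d' (negbTE tn).
  by rewrite ge_min ler0_norm; lra.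
rewrite /F leNgt s0 /= tE addr0 addrAC subrr add0r /GRing.scale /= mulKf //.
by rewrite subrr normr0.
Qed.

Lemma halfline_derivative_dot {R : realType} {H : completeNormedModType R}
    {dot : {dot H for (@idfun R)}} (hH : hilbert_norm dot)
    {u : R -> H} {t : R} {l : H} (w : H) : halfline_derivative u t l ->
  (s - t)^-1 * (dot (u s) w - dot (u t) w) @[s --> within [set s | 0 <= s] t^']
    --> dot l w.
Proof.
move=> h; have := dot_cvg hH _ _ w h.
have <- : (fun s => dot ((s - t)^-1 *: (u s - u t)) w)
  = fun s => (s - t)^-1 * (dot (u s) w - dot (u t) w).
  by apply/funext => s; rewrite dotZl linearBl.
exact.
Qed.

(** The dual norm bounds the value of a functional at each [w] of the unit ball, so
convergence of the difference quotients in the dual norm implies convergence at [w]. *)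
Lemma halfline_dual_derivative_eval {R : realType} {H : completeNormedModType R}
    {X : set H} {nX : H -> R} {f : R -> H -> R} {t : R} {g : H -> R} (w : H) :
    X w -> nX w <= 1 -> halfline_dual_derivative X nX f t g ->
  (s - t)^-1 * (f s w - f t w) @[s --> within [set s | 0 <= s] t^'] --> g w.
Proof.
move=> Xw w1 /fine_cvgP [fin /cvgrPdist_lt h0].
apply/cvgrPdist_lt => eps e0; have := h0 _ e0; apply: filterS2 fin => s sfin.
rewrite sub0r normrN distrC; apply: le_lt_trans.
apply: le_trans (ler_norm _); rewrite -lee_fin fineK //.
by apply: ereal_sup_ubound; exists w.
Qed.

Section modes.
Context {R : realType} {H : completeNormedModType R}.
Context {dot : {dot H for (@idfun R)}} (hH : hilbert_norm dot).
Context {D : set H} {A : H -> H} (hA : admissible_operator dot D A).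
Context {e : nat -> H} {lam : nat -> R} (he : eigenbasis dot D A e lam).

Let e_on := eig_orthonormal he.

Lemma eigenvalue_gt0 n : 0 < lam n.
Proof.
have [a a0 ha] := adm_coercive hA; have := ha _ (eig_dom he n).
rewrite (eig_eigen he) dotZl e_on eqxx !mulr1; exact: lt_le_trans.
Qed.

Lemma eigenvalue_ge n : lam 0%N <= lam n.
Proof. exact: eig_sorted he _ _ _. Qed.

(** [A] is symmetric, being contained in its adjoint. *)
Lemma dot_A_eigenvector x n : D x -> dot (A x) (e n) = lam n * dot x (e n).
Proof.
have [_] := adm_self_adjoint hA (e n) (lam n *: e n); move=> /(_ _) h.
by move=> Dx; rewrite h ?dotZr //; split; [exact: eig_dom he n | exact: eig_eigen he n].
Qed.

Lemma Adom_of_domain {x} : D x -> Adom dot e lam 1 x.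
Proof.
move=> Dx; apply: (@is_cvg_series_bounded _ _ (`|A x| ^+ 2)) => n.
  by rewrite mulr_ge0 ?sqr_ge0 ?powR_ge0.
apply: le_trans (bessel hH e_on (A x) n); rewrite /series /=.
apply: ler_sum => k _; rewrite dot_A_eigenvector // exprMn.
by rewrite mulr1 (powR_mulrn 2) // ltW // eigenvalue_gt0.
Qed.

Lemma Aext_eigenvector s (f : H -> R) k n :
  Aext dot e lam s f (k *: e n) = k * (lam n `^ s * f (e n)).
Proof.
apply: cvg_lim => //.
have := @cvg_series_single _ _
  (fun m => lam m `^ s * f (e m) * dot (e m) (k *: e n)) n.
rewrite dotZr e_on eqxx mulr1 mulrC; apply => m mn.
by rewrite dotZr e_on (negbTE mn) !mulr0.
Qed.

Lemma Vset_eigenvector k n : Vset dot e lam (k *: e n).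
Proof.
rewrite /Vset /Adom /=; apply/cvg_ex; eexists.
apply: (@cvg_series_single _ _ _ n) => m mn.
by rewrite dotZl e_on eq_sym (negbTE mn) mulr0 expr0n mulr0.
Qed.

Lemma normV_eigenvector k n : normV dot e lam (k *: e n) = lam n `^ (1 / 2) * `|k|.
Proof.
rewrite /normV /Apow /Avec.
rewrite (cvg_lim _ (@cvg_series_single _ _ _ n _)) //.
  rewrite dotZl e_on eqxx mulr1 normrZ (norm_orthonormal hH e_on) mulr1.
  by rewrite normrM ger0_norm // powR_ge0.
by move=> m mn; rewrite dotZl e_on eq_sym (negbTE mn) !mulr0 scale0r.
Qed.

Lemma domain_eigenvector k n : D (k *: e n).
Proof.
have [D0 hlin] := adm_linear hA.
by have [] := hlin k (e n) 0 (eig_dom he n) D0; rewrite addr0.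
Qed.

Lemma normW_eigenvector k n : normW A (k *: e n) = lam n * `|k|.
Proof.
have [D0 hlin] := adm_linear hA.
have A0 : A 0 = 0.
  have [_] := hlin 1 0 0 D0 D0; rewrite !scale1r addr0 => /eqP.
  by rewrite -subr_eq subrr eq_sym => /eqP.
have [_] := hlin k (e n) 0 (eig_dom he n) D0; rewrite A0 !addr0 /normW => ->.
rewrite (eig_eigen he) !normrZ (norm_orthonormal hH e_on) mulr1 mulrC.
by rewrite gtr0_norm // eigenvalue_gt0.
Qed.

Context {alpha beta : R} {u v u' v' : R -> H}.
Context (hsol : is_solution dot D A e lam alpha beta u v u' v').

Let difference_quotient_scale (k : R) (f F : R -> R) (t l : R) : k != 0 ->
    (forall s, F s = k * f s) ->
    (s - t)^-1 * (F s - F t) @[s --> within [set s | 0 <= s] t^'] --> k * l ->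
  (s - t)^-1 * (f s - f t) @[s --> within [set s | 0 <= s] t^'] --> l.
Proof.
move=> k0 Ff h.
have -> : (fun s => (s - t)^-1 * (f s - f t))
  = fun s => k^-1 * ((s - t)^-1 * (F s - F t)).
  by apply/funext => s; rewrite !Ff -mulrBr mulrCA mulKf.
by rewrite -[l](mulKf k0); exact: cvgMr h.
Qed.

(** Evaluation of the weak equation at an eigenvector, scaled into the unit ball of
the test space because the dual norm controls only that ball. *)
Lemma mode_equation1 n (t : R) : 0 <= t ->
  (s - t)^-1 * (dot (u' s) (e n) - dot (u' t) (e n))
    @[s --> within [set s | 0 <= s] t^'] -->
  - dot (u' t) (e n) - lam n * dot (u t) (e n)
    - alpha * lam n `^ beta * dot (v t) (e n).
Proof.
move=> t0; have [g [_ gder geq]] := sol_eq1 hsol t0.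
have lpos := eigenvalue_gt0 n; pose k := (lam n `^ (1 / 2))^-1.
have k0 : 0 < k by rewrite invr_gt0 powR_gt0.
have wV := Vset_eigenvector k n.
have w1 : normV dot e lam (k *: e n) <= 1.
  by rewrite normV_eigenvector gtr0_norm // divff // gt_eqF // powR_gt0.
have gE : g (k *: e n) = k * (- dot (u' t) (e n) - lam n * dot (u t) (e n)
    - alpha * lam n `^ beta * dot (v t) (e n)).
  have := geq _ wV; rewrite !Aext_eigenvector !dotZr powRr1 ?(ltW lpos) //.
  lra.
apply: (@difference_quotient_scale k (fun s => dot (u' s) (e n))
  (fun s => dot (u' s) (k *: e n))); first by rewrite gt_eqF.
  by move=> s; rewrite dotZr.
by rewrite -gE; exact: halfline_dual_derivative_eval wV w1 gder.
Qed.

Lemma mode_equation2 n (t : R) : 0 <= t ->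
  (s - t)^-1 * (dot (v' s) (e n) - dot (v' t) (e n))
    @[s --> within [set s | 0 <= s] t^'] -->
  - (lam n ^+ 2 * dot (v t) (e n)) - alpha * lam n `^ beta * dot (u t) (e n).
Proof.
move=> t0; have [g [_ gder geq]] := sol_eq2 hsol t0.
have lpos := eigenvalue_gt0 n; pose k := (lam n)^-1.
have k0 : 0 < k by rewrite invr_gt0.
have wD := domain_eigenvector k n.
have w1 : normW A (k *: e n) <= 1.
  by rewrite normW_eigenvector gtr0_norm // divff // gt_eqF.
have gE : g (k *: e n) = k * (- (lam n ^+ 2 * dot (v t) (e n))
    - alpha * lam n `^ beta * dot (u t) (e n)).
  have := geq _ wD; rewrite !Aext_eigenvector (powR_mulrn 2) ?(ltW lpos) //.
  lra.
apply: (@difference_quotient_scale k (fun s => dot (v' s) (e n))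
  (fun s => dot (v' s) (k *: e n))); first by rewrite gt_eqF.
  by move=> s; rewrite dotZr.
by rewrite -gE; exact: halfline_dual_derivative_eval wD w1 gder.
Qed.

End modes.

(** * Summation over the modes *)

(** The n-th mode in the variables in which the equations have the form studied in
[mode_decay]; its sum over n is the squared norm of V x W x H x H. *)
Definition solution_mode_norm2 {R : realType} {H : completeNormedModType R}
    (dot : {dot H for (@idfun R)}) (e : nat -> H) (lam : nat -> R)
    (u v u' v' : R -> H) (n : nat) (t : R) : R :=
  mode_norm2 (dot (u' t) (e n)) (dot (v' t) (e n))
    (lam n `^ (1 / 2) * dot (u t) (e n)) (lam n * dot (v t) (e n)).

Lemma solution_mode_decay {R : realType} {H : completeNormedModType R}
    {dot : {dot H for (@idfun R)}} (hH : hilbert_norm dot)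
    {D : set H} {A : H -> H} (hA : admissible_operator dot D A)
    {e : nat -> H} {lam : nat -> R} (he : eigenbasis dot D A e lam)
    {alpha beta : R} :
    beta <= 3 / 2 -> `|alpha| < lam 0%N `^ ((3 - 2 * beta) / 2) ->
  exists2 C : R, 0 < C & forall u v u' v' : R -> H,
    is_solution dot D A e lam alpha beta u v u' v' ->
    forall n (t : R), 0 <= t ->
      t * (alpha ^+ 2 * lam n `^ (2 * beta - 4))
        * solution_mode_norm2 dot e lam u v u' v' n t
      <= C * solution_mode_norm2 dot e lam u v u' v' n 0.
Proof.
move=> hbeta halpha; have lpos n : 0 < lam n := eigenvalue_gt0 hA he n.
(* Uniform bound of the coupling: lam^(beta - 3/2) is largest at the lowest mode. *)
pose delta := `|alpha| * lam 0%N `^ (beta - 3 / 2).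
have delta1 : delta < 1.
  rewrite /delta (_ : beta - 3 / 2 = - ((3 - 2 * beta) / 2)); last by field.
  by rewrite powRN ltr_pdivrMr ?powR_gt0 // mul1r.
pose eps := (1 - delta) / 2.
have e0 : 0 < eps by rewrite /eps; lra.
have [C C0 hC] := mode_decay e0 (powR_gt0 (1 / 2) (lpos 0%N)).
exists C => // u v u' v' hsol n t t0.
have ext := @halfline_derivative_extension R.
have [P [PE dP]] := ext _ _ (fun t => mode_equation1 hH hA he hsol n t).
have [Q [QE dQ]] := ext _ _ (fun t => mode_equation2 hH hA he hsol n t).
have [U [UE dU]] := ext _ _
  (fun t t0 => halfline_derivative_dot hH (e n) (sol_du hsol t0)).
have [V [VE dV]] := ext _ _
  (fun t t0 => halfline_derivative_dot hH (e n) (sol_dv hsol t0)).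
pose mu := lam n `^ (1 / 2); pose b := alpha * lam n `^ (beta - 3 / 2).
have mu2 : lam n = mu ^+ 2.
  by rewrite /mu powR_half_sqr // ltW.
have mu0 : 0 < mu by rewrite powR_gt0.
have hb : `|b| <= 1 - 2 * eps.
  rewrite (_ : 1 - 2 * eps = delta); last by rewrite /eps; field.
  rewrite normrM (ger0_norm (powR_ge0 _ _)) ler_wpM2l //.
  by rewrite ler_powR_npos // ?(eigenvalue_ge he) //; lra.
have hmu : lam 0%N `^ (1 / 2) <= mu.
  rewrite ge0_ler_powR ?nnegrE ?(ltW (lpos _)) ?(eigenvalue_ge he) //.
have lamD x y : lam n `^ (x + y) = lam n `^ x * lam n `^ y.
  by rewrite powRD // (gt_eqF (lpos n)) implybT.
have bE : alpha * lam n `^ beta = b * mu ^+ 3.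
  rewrite /b -mulrA -powR_mulrn ?(ltW mu0) // /mu -powRrM -lamD.
  by congr (_ * _ `^ _); field.
have := hC b mu P Q (fun s => mu * U s) (fun s => lam n * V s) hb hmu
  _ _ _ _ t t0.
rewrite (PE _ t0) (QE _ t0) (UE _ t0) (VE _ t0).
rewrite (PE _ (lexx 0)) (QE _ (lexx 0)) (UE _ (lexx 0)) (VE _ (lexx 0)).
have -> : (b / mu) ^+ 2 = alpha ^+ 2 * lam n `^ (2 * beta - 4).
  have -> : mu^-1 = lam n `^ (- (1 / 2)) by rewrite powRN.
  rewrite /b -mulrA -lamD exprMn powR_sqr ?(ltW (lpos n)) //.
  by congr (_ * _ `^ _); field.
apply.
- move=> s s0; have dUs := dU s s0.
  by apply: is_derive_eq; rewrite PE.
- move=> s s0; have dPs := dP s s0.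
  apply: is_derive_eq; rewrite PE // UE // VE // bE mu2; ring.
- move=> s s0; have dVs := dV s s0.
  by apply: is_derive_eq; rewrite QE // mu2.
- move=> s s0; have dQs := dQ s s0.
  apply: is_derive_eq; rewrite UE // VE // bE mu2; ring.
Qed.

(** The exponents on the left are those for which the four terms carry the common
spectral weight [lam^r] against the squared norm of the mode. The condition
[r <= 2 beta - 4] compares this weight with the decay rate of the modes;
[r <= - 2] keeps the powers of A within the domains of u', v', u and v. *)
Lemma weighted_decay {R : realType} {H : completeNormedModType R}
    {dot : {dot H for (@idfun R)}} (hH : hilbert_norm dot)
    {D : set H} {A : H -> H} (hA : admissible_operator dot D A)
    {e : nat -> H} {lam : nat -> R} (he : eigenbasis dot D A e lam)
    {alpha beta r : R} :
    beta <= 3 / 2 -> alpha != 0 ->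
    `|alpha| < lam 0%N `^ ((3 - 2 * beta) / 2) ->
    r <= 2 * beta - 4 -> r <= - 2 ->
  exists2 c : R, 0 < c & forall u v u' v' : R -> H,
    is_solution dot D A e lam alpha beta u v u' v' ->
    forall t : R, 0 < t ->
      normW'_Apow dot e lam ((r + 2) / 2) (u' t) ^+ 2
      + normW'_Apow dot e lam ((r + 2) / 2) (v' t) ^+ 2
      + normW'_Apow dot e lam ((r + 3) / 2) (u t) ^+ 2
      + normW'_Apow dot e lam ((r + 4) / 2) (v t) ^+ 2
      <= c / t * (`|u' 0| ^+ 2 + `|v' 0| ^+ 2
                  + normV dot e lam (u 0) ^+ 2 + normW A (v 0) ^+ 2).
Proof.
move=> hbeta halpha0 halpha hr hr2.
have lpos n : 0 < lam n := eigenvalue_gt0 hA he n.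
have lge n : lam 0%N <= lam n := eigenvalue_ge he n.
have e_on := eig_orthonormal he; have e_total := eig_total he.
have a2 : 0 < alpha ^+ 2 by rewrite exprn_even_gt0.
have [C C0 hC] := solution_mode_decay hH hA he hbeta halpha.
pose L := lam 0%N `^ (r - (2 * beta - 4)).
have L0 : 0 < L by rewrite powR_gt0.
exists (L / alpha ^+ 2 * C); first by rewrite mulr_gt0 // divr_gt0.
move=> u v u' v' hsol t t0; have t0' := ltW t0.
pose S n s := solution_mode_norm2 dot e lam u v u' v' n s.
have S_ge0 n s : 0 <= S n s.
  by rewrite /S /solution_mode_norm2 /mode_norm2 !addr_ge0 ?sqr_ge0.
have mode n : lam n `^ r * S n t <= L / alpha ^+ 2 * C / t * S n 0.
  have h := hC _ _ _ _ hsol n t t0'; rewrite -/(S n t) -/(S n 0) in h.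
  have rL : lam n `^ r <= L * lam n `^ (2 * beta - 4).
    rewrite [in leLHS](_ : r = r - (2 * beta - 4) + (2 * beta - 4)); last by ring.
    rewrite powRD; last by rewrite (gt_eqF (lpos n)) implybT.
    by rewrite ler_wpM2r ?powR_ge0 // ler_powR_npos //; lra.
  apply: le_trans (ler_wpM2r (S_ge0 n t) rL) _.
  have c0 : 0 < L / alpha ^+ 2 / t by rewrite !divr_gt0.
  have := ler_wpM2l (ltW c0) h.
  have -> : L / alpha ^+ 2 / t * (t * (alpha ^+ 2 * lam n `^ (2 * beta - 4)) * S n t)
      = L * lam n `^ (2 * beta - 4) * S n t by field; rewrite halpha0 gt_eqF.
  by have -> : L / alpha ^+ 2 / t * (C * S n 0) = L / alpha ^+ 2 * C / t * S n 0
    by ring.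
have initial N : \sum_(0 <= n < N) S n 0 <= `|u' 0| ^+ 2 + `|v' 0| ^+ 2
                  + normV dot e lam (u 0) ^+ 2 + normW A (v 0) ^+ 2.
  have [uV _] := sol_u hsol (lexx 0); have [vD _] := sol_v hsol (lexx 0).
  rewrite /S /solution_mode_norm2 /mode_norm2 !big_split /=.
  apply: lerD; [apply: lerD; [apply: lerD|]|].
  - exact: (bessel hH e_on).
  - exact: (bessel hH e_on).
  - apply: le_trans (sum_le_normV_sqr hH e_on (lpos 0%N) lge N uV).
    by apply: ler_sum => n _; rewrite exprMn powR_half_sqr // ltW.
  - apply: le_trans (bessel hH e_on _ N).
    by apply: ler_sum => n _; rewrite (dot_A_eigenvector hA he).
have [uV _] := sol_u hsol t0'; have [vD _] := sol_v hsol t0'.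
have low s x : s <= 0 -> Adom dot e lam s x.
  by move=> s0; apply: (Adom_le (lpos 0%N) lge s0); exact: (Adom0 hH e_on).
have cp := normW'_Apow_sqr_cvg hH e_on e_total (lpos 0%N) lge
  (low ((r + 2) / 2) (u' t) (ltac:(lra) : (r + 2) / 2 <= 0)).
have cq := normW'_Apow_sqr_cvg hH e_on e_total (lpos 0%N) lge
  (low ((r + 2) / 2) (v' t) (ltac:(lra) : (r + 2) / 2 <= 0)).
have cu := normW'_Apow_sqr_cvg hH e_on e_total (lpos 0%N) lge
  (Adom_le (lpos 0%N) lge (ltac:(lra) : (r + 3) / 2 <= 1 / 2) uV).
have cv := normW'_Apow_sqr_cvg hH e_on e_total (lpos 0%N) lge
  (Adom_le (lpos 0%N) lge (ltac:(lra) : (r + 4) / 2 <= 1)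
    (Adom_of_domain hH hA he vD)).
apply: (ler_cvg_to (cvgD (cvgD (cvgD cp cq) cu) cv) (cvg_cst _)).
apply: nearW => N /=; rewrite /series /= !fctE -!big_split /=.
apply: (@le_trans _ _ (\sum_(0 <= n < N) L / alpha ^+ 2 * C / t * S n 0)); last first.
  by rewrite -mulr_sumr ler_wpM2l // ltW // divr_gt0 // mulr_gt0 // divr_gt0.
apply: ler_sum => n _; apply: le_trans (mode n).
rewrite /S /solution_mode_norm2 /mode_norm2 !exprMn powR_half_sqr ?(ltW (lpos n)) //.
have -> : 2 * ((r + 2) / 2) - 2 = r by field.
have -> : 2 * ((r + 3) / 2) - 2 = r + 1 by field.
have -> : 2 * ((r + 4) / 2) - 2 = r + 2 by field.
have lamD x y : lam n `^ (x + y) = lam n `^ x * lam n `^ y.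
  by rewrite powRD // (gt_eqF (lpos n)) implybT.
have -> : lam n `^ (r + 2) = lam n `^ r * lam n ^+ 2.
  by rewrite lamD (powR_mulrn 2) // ltW.
rewrite lamD powRr1 ?(ltW (lpos n)) //.
by rewrite le_eqVlt; apply/orP; left; apply/eqP; ring.
Qed.

Theorem theorem3p3 (R : realType) (H : completeNormedModType R)
    (dot : {dot H for (@idfun R)}) (hH : hilbert_norm dot)
    (D : set H) (A : H -> H) (hA : admissible_operator dot D A)
    (e : nat -> H) (lam : nat -> R) (he : eigenbasis dot D A e lam)
    (alpha beta : R) (hbeta0 : 0 <= beta) (hbeta1 : beta <= 3 / 2)
    (halpha0 : alpha != 0)
    (halpha1 : `|alpha| < lam 0%N `^ ((3 - 2 * beta) / 2)) :
  exists2 c : R, 0 < c &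
    forall u v u' v' : R -> H,
      is_solution dot D A e lam alpha beta u v u' v' ->
      (beta <= 1 -> forall t : R, 0 < t ->
        normW'_Apow dot e lam (beta / 2 - 1) (u' t) ^+ 2
        + normW'_Apow dot e lam (beta / 2 - 1) (v' t) ^+ 2
        + normW'_Apow dot e lam ((beta - 1) / 2) (u t) ^+ 2
        + normW'_Apow dot e lam (beta / 2) (v t) ^+ 2
        <= c / t * (`|u' 0| ^+ 2 + `|v' 0| ^+ 2
                    + normV dot e lam (u 0) ^+ 2 + normW A (v 0) ^+ 2))
      /\
      (1 <= beta -> forall t : R, 0 < t ->
        normW'_Apow dot e lam (- (beta / 2)) (u' t) ^+ 2
        + normW'_Apow dot e lam (- (beta / 2)) (v' t) ^+ 2
        + normW'_Apow dot e lam ((1 - beta) / 2) (u t) ^+ 2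
        + normW'_Apow dot e lam (1 - beta / 2) (v t) ^+ 2
        <= c / t * (`|u' 0| ^+ 2 + `|v' 0| ^+ 2
                    + normV dot e lam (u 0) ^+ 2 + normW A (v 0) ^+ 2)).
Proof.
have bound r : r <= 2 * beta - 4 -> r <= - 2 -> _ :=
  weighted_decay hH hA he hbeta1 halpha0 halpha1.
have [beta_le1|beta_gt1] := leP beta 1.
  have [||c c0 hc] := bound (beta - 4); [lra | lra |].
  exists c => // u v u' v' hsol; split => [_ t t0 | beta_ge1 t t0].
    have := hc _ _ _ _ hsol t t0.
    have -> : (beta - 4 + 2) / 2 = beta / 2 - 1 by field.
    have -> : (beta - 4 + 3) / 2 = (beta - 1) / 2 by field.
    by have -> : (beta - 4 + 4) / 2 = beta / 2 by field.
  (* Both estimates hold at beta = 1, where their exponents coincide. *)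
  have b1 : beta = 1 by apply/le_anti/andP.
  have := hc _ _ _ _ hsol t t0; rewrite b1.
  have -> : (1 - 4 + 2) / 2 = - (1 / 2) :> R by field.
  have -> : (1 - 4 + 3) / 2 = (1 - 1) / 2 :> R by field.
  by have -> : (1 - 4 + 4) / 2 = 1 - 1 / 2 :> R by field.
have [||c c0 hc] := bound (- beta - 2); [lra | lra |].
exists c => // u v u' v' hsol; split => [beta_le1 | _] t t0; first lra.
have := hc _ _ _ _ hsol t t0.
have -> : (- beta - 2 + 2) / 2 = - (beta / 2) by field.
have -> : (- beta - 2 + 3) / 2 = (1 - beta) / 2 by field.
by have -> : (- beta - 2 + 4) / 2 = 1 - beta / 2 by field.
Qed.
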